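(* Let $\alpha<0$, let $\mathcal{A}$ be a real antisymmetric $n\times n$ matrix, and let $\mathbf{C}$ be a rotating-dilating soliton with parameters $(\alpha,\mathcal{A})$ on which $V(\mathbf{C},\mathbf{T})$ is constant. Then $\mathbf{C}$ is \begin{itemize} \item a circle with radius $1/\sqrt{-\alpha}$ (centered at the origin) in a complex line in one of the eigenspaces $F_k$, or \item an Abresch-Langer curve in the null space $N(\mathcal{A})$ of $\mathcal{A}$ (or a straight line through the origin in $N(\mathcal{A})$). \end{itemize} The functional $V$ vanishes on the Abresch-Langer solitons in $N(\mathcal{A})$. For the circles in $F_k$ one has \[ V=\pm\frac{\Omega_k}{\sqrt{-e\alpha}}, \] with the sign depending on their orientation.
   Context: A rotating-dilating soliton with parameters $(\alpha,\mathcal{A})$ is a smooth curve $\mathbf{C}:\mathbb{R}\to\mathbb{R}^n$, parametrized by arc length $s$, satisfying $\mathbf{C}_{ss}=(\alpha+\mathcal{A})\mathbf{C}+\lambda\mathbf{C}_s$, where $\alpha$ stands for $\alpha$ times the identity and $\lambda(s)=-\langle(\alpha+\mathcal{A})\mathbf{C},\mathbf{C}_s\rangle$ is determined by $\mathbf{C}_s\perp\mathbf{C}_{ss}$. $\mathbf{T}=\mathbf{C}_s$ and $V(\mathbf{C},\mathbf{T})=e^{\frac{\alpha}{2}\|\mathbf{C}\|^2}\langle\mathbf{T},\mathcal{A}\mathbf{C}\rangle$. Let $0<\Omega_1<\dots<\Omega_{\bar m}$ be the distinct numbers such that $\pm\Omega_k$ are the nonzero eigenvalues of $i\mathcal{A}$,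 and $F_k=N(\mathcal{A}^2+\Omega_k^2\mathbf{1})$, with complex structure $\mathcal{J}_k=\Omega_k^{-1}\mathcal{A}|_{F_k}$; a complex line in $F_k$ is a real 2-plane spanned by $\mathbf{x},\mathcal{J}_k\mathbf{x}$ with $0\neq\mathbf{x}\in F_k$. An Abresch-Langer curve is a planar (contained in a two-dimensional linear subspace), compact or non-compact, purely shrinking soliton, i.e. an arc length parametrized solution of $\mathbf{C}_{ss}=\alpha\mathbf{C}+\lambda\mathbf{C}_s$, $\lambda=-\alpha\langle\mathbf{C},\mathbf{C}_s\rangle$. *)

(* Defs.v *)
From HB Require Import structures.
From mathcomp Require Export all_boot all_order all_algebra.
From mathcomp Require Export all_classical all_reals all_analysis.
From mathcomp Require Export complex.
Set Implicit Arguments.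
Unset Strict Implicit.
Unset Printing Implicit Defensive.
Export Order.TTheory GRing.Theory Num.Theory.
Export numFieldNormedType.Exports.

Local Open Scope classical_set_scope.
Local Open Scope ring_scope.

Section Defs.
Variable R : realType.
Variable n : nat.
Implicit Types (alpha r w : R) (A : 'M[R]_n) (x y : 'cV[R]_n).
Implicit Types (C : R -> 'cV[R]_n) (P L : {vspace 'cV[R]_n}).

(* The library norm `|x| on 'cV[R]_n is the sup norm, so the Euclidean
   structure is defined here. *)
Definition dot x y : R := \sum_(i < n) x i 0 * y i 0.
Definition enorm x : R := Num.sqrt (dot x x).

Definition smooth C : Prop :=
  forall (k : nat) (s : R), derivable (derive1n k C) s 1.

Definition arc_length C : Prop := forall s, enorm (derive1 C s) = 1.

Definition soliton alpha A C : Prop :=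
  [/\ smooth C, arc_length C &
      forall s,
        let lambda := - dot ((alpha%:M + A) *m C s) (derive1 C s) in
        derive1n 2 C s = (alpha%:M + A) *m C s + lambda *: derive1 C s].

Definition Vfun alpha A (c t : 'cV[R]_n) : R :=
  expR (alpha / 2 * enorm c ^+ 2) * dot t (A *m c).

Definition antisymmetric_mx A : Prop := A^T = - A.

(* The null space {x | A *m x = 0} of column vectors; mxalgebra's kermx is the
   row kernel instead. *)
Definition nullspace A : {vspace 'cV[R]_n} := lker (linfun (mulmx A)).

Definition iA A : 'M[R[i]]_n := 'i%C *: map_mx (real_complex R) A.

(* Omega_0 < ... < Omega_(m-1) are positive and the nonzero eigenvalues of i A
   are exactly the numbers +- Omega_k.  (mxalgebra's eigenvalue uses row
   eigenvectors, which gives the same spectrum for a square matrix.) *)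
Definition frequencies A (m : nat) (Omega : 'I_m -> R) : Prop :=
  [/\ forall k, 0 < Omega k,
      forall j k : 'I_m, (j < k)%N -> Omega j < Omega k &
      forall z : R[i], (eigenvalue (iA A) z /\ z != 0) <->
        exists k, z = (Omega k)%:C%C \/ z = - (Omega k)%:C%C].

Definition Fspace A w : {vspace 'cV[R]_n} := nullspace (A *m A + (w ^+ 2)%:M).

Definition Jstr A w x : 'cV[R]_n := w^-1 *: (A *m x).

Definition complex_line A w L : Prop :=
  exists x, [/\ x \in Fspace A w, x != 0 & L = <<[:: x; Jstr A w x]>>%VS].

(* C runs over the whole circle of radius r about the origin of a complex line
   in F_w. *)
Definition circle_in A w r C : Prop :=
  exists2 L, complex_line A w L &
    range C = [set y | y \in L /\ enorm y = r].

(* A circle in F_w is oriented by the complex structure: positively (b = false)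
   if it moves in the direction of J_w C, negatively (b = true) if it moves in
   the direction of - J_w C. *)
Definition circle_orientation A w (b : bool) C : Prop :=
  forall s, exists2 c : R, 0 < c & derive1 C s = ((-1) ^+ b * c) *: Jstr A w (C s).

Definition contained_in C P : Prop := forall s, C s \in P.

Definition planar C : Prop := exists2 P, \dim P = 2%N & contained_in C P.

Definition abresch_langer alpha C : Prop :=
  alpha < 0 /\ soliton alpha 0 C /\ planar C.

(* C runs over a whole straight line through the origin, contained in P. *)
Definition line_through_origin_in P C : Prop :=
  exists L, [/\ \dim L = 1%N, (L <= P)%VS & range C = [set y | y \in L]].

End Defs.

(* Main.v *)
Require Import Defs.
From mathcomp Require Import all_boot all_order all_algebra.
From mathcomp Require Import all_classical all_reals all_analysis.
From mathcomp Require Import complex.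
From mathcomp Require Import ring lra.
Import Order.TTheory GRing.Theory Num.Theory.
Import numFieldNormedType.Exports.

Local Open Scope classical_set_scope.
Local Open Scope ring_scope.

(** Write [T] for [C'] and [E] for [exp (alpha/2 |C|^2)], so that
    [V = E <T, A C>]. The soliton equation gives
    [V' = E (|A C|^2 - <T, A C>^2)], that is, [E] times the squared length of
    the part of [A C] normal to the curve. If [V] is a constant [v], then
    [A C = mu T] with [mu = <T, A C>], which is [mulmx_tangent].

    If [v = 0], then [A C = 0] and [C] is a purely shrinking soliton in the
    null space of [A]. The bivector [E (C /\ T)] is then constant along [C]
    ([momentum_cst]): if it vanishes, the curve is a straight line through the
    origin, and otherwise [C] stays in the plane spanned by [C 0] and [T 0].

    If [v <> 0], then [mu] has no zero, and [mu <C, T> = <C, A C> = 0], so [T]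
    is normal to [C]. The soliton equation becomes [C'' = alpha C];
    differentiating [<C, T> = 0] gives [|C|^2 = - 1 / alpha], so [E], hence
    also [mu], is constant. Differentiating [A C = mu T] yields
    [A^2 C = alpha mu^2 C], which places [C] in [F_w] for
    [w = |mu| sqrt (- alpha)], a positive eigenvalue of [i A]. The explicit
    solution of [C'' = alpha C] runs over a full circle of the complex line
    through [C 0] ([rotating_circle]).

    A unit speed curve on a circle of radius [r] in a complex line of [F_w] has
    [T] proportional to [J C], with [<T, J C>^2 = r^2]; the function [<T, J C>]
    is differentiable, hence a constant [+- r] ([circle_speed]). This sign is
    the orientation, and with [A C = w J C] it gives the value of [V]. *)

(** * Euclidean linear algebra *)

Section EuclideanAlgebra.
Set Implicit Arguments.
Unset Strict Implicit.
Variables (R : realType) (n : nat).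
Implicit Types (x y z : 'cV[R]_n) (a b r w : R) (A : 'M[R]_n).

Lemma dotC x y : dot x y = dot y x.
Proof. by apply: eq_bigr => i _; rewrite mulrC. Qed.

Lemma dotDl x y z : dot (x + y) z = dot x z + dot y z.
Proof. by rewrite -big_split; apply: eq_bigr => i _; rewrite mxE mulrDl. Qed.

Lemma dotDr x y z : dot z (x + y) = dot z x + dot z y.
Proof. by rewrite dotC dotDl !(dotC z). Qed.

Lemma dotZl a x y : dot (a *: x) y = a * dot x y.
Proof. by rewrite mulr_sumr; apply: eq_bigr => i _; rewrite mxE mulrA. Qed.

Lemma dotZr a x y : dot x (a *: y) = a * dot x y.
Proof. by rewrite dotC dotZl dotC. Qed.

Lemma dotNl x y : dot (- x) y = - dot x y.
Proof. by rewrite -scaleN1r dotZl mulN1r. Qed.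

Lemma dotNr x y : dot x (- y) = - dot x y.
Proof. by rewrite dotC dotNl dotC. Qed.

(** Expands [dot] by bilinearity. *)
Definition dotE := (dotDl, dotDr, dotZl, dotZr, dotNl, dotNr).

Lemma dot0r x : dot x 0 = 0.
Proof. by rewrite -(scale0r 0) dotZr mul0r. Qed.

Lemma dot0l x : dot 0 x = 0.
Proof. by rewrite dotC dot0r. Qed.

Lemma dotxx_ge0 x : 0 <= dot x x.
Proof. by apply: sumr_ge0 => i _; rewrite -expr2 sqr_ge0. Qed.

Lemma dotxx_eq0 x : dot x x = 0 -> x = 0.
Proof.
move=> /eqP; rewrite psumr_eq0 => [/allP x0|i _]; last by rewrite -expr2 sqr_ge0.
apply/matrixP => i j; rewrite ord1 mxE.
by have := x0 i (mem_index_enum i); rewrite /= mulf_eq0 orbb => /eqP.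
Qed.

Lemma dotxx_gt0 x : x != 0 -> 0 < dot x x.
Proof.
move=> x0; rewrite lt_neqAle dotxx_ge0 andbT eq_sym.
by apply: contra x0 => /eqP/dotxx_eq0 ->.
Qed.

Lemma enorm_sqr x : enorm x ^+ 2 = dot x x.
Proof. by rewrite sqr_sqrtr// dotxx_ge0. Qed.

Lemma enorm_eq x r : 0 <= r -> dot x x = r ^+ 2 -> enorm x = r.
Proof. by move=> r0 xr; rewrite /enorm xr sqrtr_sqr ger0_norm. Qed.

Lemma dot_mulmx_antisym A x y : antisymmetric_mx A ->
  dot (A *m x) y = - dot x (A *m y).
Proof.
move=> Aanti; have dotM u v : dot u v = (u^T *m v) 0 0.
  by rewrite mxE; apply: eq_bigr => i _; rewrite mxE.
by rewrite !dotM trmx_mul Aanti mulmxN mulNmx mxE mulmxA.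
Qed.

Lemma dot_antisym_self A x : antisymmetric_mx A -> dot x (A *m x) = 0.
Proof. by move=> Aanti; have := dot_mulmx_antisym x x Aanti; rewrite dotC; lra. Qed.

Lemma memv_nullspace A x : (x \in nullspace A) = (A *m x == 0).
Proof. by rewrite memv_ker lfunE. Qed.

Lemma memv_Fspace A w x : (x \in Fspace A w) = (A *m (A *m x) == - w ^+ 2 *: x).
Proof.
by rewrite memv_nullspace mulmxDl mul_scalar_mx -mulmxA addr_eq0 scaleNr.
Qed.

Lemma memv_span2 x y z :
  reflect (exists a b, z = a *: x + b *: y) (z \in <<[:: x; y]>>%VS).
Proof.
rewrite span_cons span_seq1; apply: (iffP idP) => [/memv_addP|].
  by case=> _ /vlineP[a ->] [_ /vlineP[b ->] ->]; exists a, b.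
by case=> a [b ->]; apply: memv_add; apply/vlineP; [exists a|exists b].
Qed.

End EuclideanAlgebra.

(** * Derivatives of vector-valued functions *)

Section VectorDerivatives.
Set Implicit Arguments.
Unset Strict Implicit.
Variable R : realType.
Implicit Types (f g : R -> R) (s : R).

Lemma is_deriveMfun f g s df dg :
  is_derive s 1 f df -> is_derive s 1 g dg ->
  is_derive s 1 (fun t => f t * g t) (df * g s + f s * dg).
Proof.
move=> hf hg; apply: (is_derive_eq (is_deriveM hf hg)).
by rewrite /GRing.scale/= addrC mulrC.
Qed.

Lemma is_derive_mxP m n (M : R -> 'M[R]_(m, n)) s dM :
  is_derive s 1 M dM <-> forall i j, is_derive s 1 (fun t => M t i j) (dM i j).
Proof.
split=> [[Mder <-] i j|h].
  apply: DeriveDef; first exact: (derivable_mxP M s 1).1.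
  by rewrite derive_mx// mxE.
have Mder : derivable M s 1.
  by apply: (derivable_mxP M s 1).2 => i j; have [] := h i j.
apply: DeriveDef => //.
by rewrite derive_mx//; apply/matrixP => i j; rewrite mxE; have [] := h i j.
Qed.

Lemma is_derive_sumfun m (F : 'I_m -> R -> R) s (dF : 'I_m -> R) :
  (forall i, is_derive s 1 (F i) (dF i)) ->
  is_derive s 1 (fun t => \sum_(i < m) F i t) (\sum_(i < m) dF i).
Proof. by move=> h; have := is_derive_sum h; rewrite fct_sumE. Qed.

Variable n : nat.
Implicit Types (C D : R -> 'cV[R]_n) (A : 'M[R]_n).

Lemma is_derive_dot C D s dC dD :
  is_derive s 1 C dC -> is_derive s 1 D dD ->
  is_derive s 1 (fun t => dot (C t) (D t)) (dot dC (D s) + dot (C s) dD).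
Proof.
move=> /is_derive_mxP hC /is_derive_mxP hD.
by rewrite -big_split; apply: is_derive_sumfun => i; exact: is_deriveMfun.
Qed.

Lemma is_derive_mulmx A C s dC :
  is_derive s 1 C dC -> is_derive s 1 (fun t => A *m C t) (A *m dC).
Proof.
move=> /is_derive_mxP hC; apply/is_derive_mxP => i j; rewrite mxE.
under eq_fun do rewrite mxE.
have h k : is_derive s 1 (fun t => A i k * C t k j) (A i k * dC k j).
  by apply: is_derive_eq (is_deriveMfun (is_derive_cst (A i k) s 1) (hC k j)) _;
    rewrite mul0r add0r.
exact: is_derive_sumfun h.
Qed.

Lemma is_derive_scale f C s df dC :
  is_derive s 1 f df -> is_derive s 1 C dC ->
  is_derive s 1 (fun t => f t *: C t) (df *: C s + f s *: dC).
Proof.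
move=> hf /is_derive_mxP hC; apply/is_derive_mxP => i j; rewrite !mxE.
under eq_fun do rewrite mxE.
exact: is_deriveMfun.
Qed.

Lemma derive0_cst C : (forall s, is_derive s 1 C 0) -> forall s t, C s = C t.
Proof.
move=> h s t; apply/matrixP => i j.
apply: (@is_derive_0_is_cst _ (fun t => C t i j)) => u.
by have /is_derive_mxP/(_ i j) := h u; rewrite mxE.
Qed.

Lemma is_derive_expsq alpha C s T :
  is_derive s 1 C T ->
  is_derive s 1 (fun t => expR (alpha / 2 * dot (C t) (C t)))
    (expR (alpha / 2 * dot (C s) (C s)) * (alpha * dot (C s) T)).
Proof.
move=> hC.
have h := is_deriveZ (alpha / 2) (is_derive_dot hC hC).
apply: (is_derive_eq (is_derive1_comp (is_derive_expR _) h)).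
by rewrite /GRing.scale/= (dotC T); congr (_ * _); field.
Qed.

Lemma smooth_is_derive C s : smooth C -> is_derive s 1 C (derive1 C s).
Proof.
move=> Csm; have Cder : derivable C s 1 := Csm 0%N s.
by apply: (DeriveDef Cder); rewrite derive1E.
Qed.

Lemma smooth_is_derive2 C s :
  smooth C -> is_derive s 1 (derive1 C) (derive1n 2 C s).
Proof.
move=> Csm; have Cder : derivable (derive1 C) s 1 := Csm 1%N s.
by apply: (DeriveDef Cder); rewrite -derive1E.
Qed.

Lemma is_deriveBfun C D s dC dD :
  is_derive s 1 C dC -> is_derive s 1 D dD ->
  is_derive s 1 (fun t => C t - D t) (dC - dD).
Proof. exact: is_deriveB. Qed.

Lemma is_deriveDfun C D s dC dD :
  is_derive s 1 C dC -> is_derive s 1 D dD ->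
  is_derive s 1 (fun t => C t + D t) (dC + dD).
Proof. exact: is_deriveD. Qed.

Lemma is_derive_const (x : 'cV[R]_n) s : is_derive s 1 (fun=> x) 0.
Proof. exact: is_derive_cst. Qed.

Lemma soliton_unit alpha A C s :
  soliton alpha A C -> dot (derive1 C s) (derive1 C s) = 1.
Proof. by case=> _ /(_ s) h _; rewrite -enorm_sqr h expr1n. Qed.

Lemma soliton_derive alpha A C s :
  soliton alpha A C -> is_derive s 1 C (derive1 C s).
Proof. by case=> Csm _ _; exact: smooth_is_derive. Qed.

Lemma soliton_derive2 alpha A C s : soliton alpha A C ->
  is_derive s 1 (derive1 C)
    (alpha *: C s + A *m C s
     - (alpha * dot (C s) (derive1 C s) + dot (A *m C s) (derive1 C s))
       *: derive1 C s).
Proof.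
case=> Csm _ /(_ s); cbv zeta; rewrite mulmxDl mul_scalar_mx dotDl dotZl => eqC.
by apply: (is_derive_eq (smooth_is_derive2 s Csm)); rewrite eqC scaleNr.
Qed.

End VectorDerivatives.

(** * Purely shrinking solitons *)

Section Shrinking.
Set Implicit Arguments.
Unset Strict Implicit.
Variables (R : realType) (n : nat) (alpha : R) (C : R -> 'cV[R]_n).
Hypothesis sol : soliton alpha 0 C.
Local Notation T := (derive1 C).

Lemma shrinking_derive2 (s : R) :
  is_derive s 1 T (alpha *: C s - (alpha * dot (C s) (T s)) *: T s).
Proof.
apply: (is_derive_eq (soliton_derive2 s sol)).
by rewrite mul0mx dot0l !addr0.
Qed.

(** The bivector [E (C /\ T)] at time [s], with
    [E = exp (alpha/2 |C|^2)], contracted with the vector [x]. *)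
Definition momentum (s : R) (x : 'cV[R]_n) : 'cV[R]_n :=
  expR (alpha / 2 * dot (C s) (C s)) *:
    (dot (T s) x *: C s - dot (C s) x *: T s).

(** [(C /\ T)' = C /\ T' = - alpha <C, T> (C /\ T)], while
    [E' = alpha <C, T> E]. *)
Lemma momentum_cst s t x : momentum s x = momentum t x.
Proof.
apply: (@derive0_cst R n (fun u => momentum u x)) => {s t} s.
have dC : is_derive s 1 C (T s) := soliton_derive s sol.
have dT := shrinking_derive2 s.
have dx := is_derive_const x s.
have d1 := is_derive_scale (is_derive_dot dT dx) dC.
have d2 := is_derive_scale (is_derive_dot dC dx) dT.
apply: (is_derive_eq
  (is_derive_scale (is_derive_expsq alpha dC) (is_deriveBfun d1 d2))).
apply/matrixP => i j; rewrite !mxE !dotE !dot0r; ring.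
Qed.

Lemma shrinking_planar_or_line :
  planar C \/ exists2 c : R, T 0 != 0 & forall s, C s = (s + c) *: T 0.
Proof.
have E0 s : expR (alpha / 2 * dot (C s) (C s)) != 0 by rewrite gt_eqF ?expR_gt0.
have T1 s := soliton_unit s sol.
have T0 : T 0 != 0.
  by apply/eqP => h; have := T1 0; rewrite h dot0r => /eqP; rewrite eq_sym oner_eq0.
(* Position and velocity are collinear exactly when the momentum vanishes, a
   condition that does not depend on time. *)
have collin s t : C s = dot (C s) (T s) *: T s -> C t = dot (C t) (T t) *: T t.
  move=> Cs.
  have mom0 : dot (T s) (T t) *: C s - dot (C s) (T t) *: T s = 0.
    have -> : dot (C s) (T t) = dot (T s) (T t) * dot (C s) (T s).
      by rewrite mulrC -dotZl -Cs.
    rewrite {1}Cs; move: (dot (T s) (T t)) (dot (C s) (T s)) => a b.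
    by rewrite scalerA subrr.
  have := momentum_cst t s (T t); rewrite /momentum mom0 scaler0 T1 scale1r.
  by move/eqP; rewrite scaler_eq0 (negPf (E0 t)) subr_eq0 => /eqP.
have [C0|C0] := eqVneq (C 0) (dot (C 0) (T 0) *: T 0); [right|left].
  exists (dot (C 0) (T 0)) => // s.
  have Tcst t : T t = T 0.
    apply: derive0_cst => u; apply: (is_derive_eq (shrinking_derive2 u)).
    by rewrite {1}(collin 0 u C0) scalerA subrr.
  have dC (u : R) : is_derive u 1 (fun t => C t - t *: T 0) 0.
    have dCu : is_derive u 1 C (T u) := soliton_derive u sol.
    have dl := is_derive_scale (is_derive_id u 1) (is_derive_const (T 0) u).
    apply: (is_derive_eq (is_deriveBfun dCu dl)).
    by rewrite scaler0 addr0 scale1r Tcst subrr.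
  have := derive0_cst dC s 0; rewrite scale0r subr0 => /eqP.
  by rewrite subr_eq addrC scalerDl -C0 => /eqP.
exists <<[:: C 0; T 0]>>%VS.
  apply/eqP; rewrite -[(_ == _)]/(free [:: C 0; T 0]) free_cons span_seq1.
  rewrite free_cons nil_free span_nil memv0 T0 !andbT.
  apply: contra C0 => /vlineP[c Cc].
  by rewrite [in X in _ == X]Cc dotZl T1 mulr1 Cc.
move=> s; set P := <<_>>%VS.
(* Contracting the bivector with [T s] and [C s] gives two vectors of [P], from
   which [(|C|^2 - <C, T>^2) T], then [T] and [C], are recovered. *)
have PE x : dot (T s) x *: C s - dot (C s) x *: T s \in P.
  have : momentum s x \in P.
    rewrite (momentum_cst s 0) memvZ// memvB// memvZ// memv_span// !inE eqxx//.
    by rewrite orbT.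
  by rewrite /momentum rpredZeq// (negPf (E0 s)).
have := PE (C s); have := PE (T s); rewrite T1 scale1r (dotC (T s)).
set g := dot (C s) (T s) => Pt Pc.
have TP : T s \in P.
  have : (dot (C s) (C s) - g ^+ 2) *: T s \in P.
    have -> : (dot (C s) (C s) - g ^+ 2) *: T s =
        g *: (C s - g *: T s) - (g *: C s - dot (C s) (C s) *: T s).
      by apply/matrixP => i j; rewrite !mxE; ring.
    by rewrite memvB// memvZ.
  rewrite rpredZeq => /orP[/eqP h|//]; case/eqP: C0; apply: (collin s).
  apply/eqP; rewrite -subr_eq0; apply/eqP/dotxx_eq0.
  by rewrite !dotE T1 (dotC (T s)) -/g -h; ring.
by rewrite -(subrK (g *: T s) (C s)) memvD// memvZ.
Qed.

End Shrinking.

(** * Circles *)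

Section Circles.
Set Implicit Arguments.
Unset Strict Implicit.
Variable R : realType.
Implicit Types (k r a b w : R).

Lemma cos_sin_surj a b : a ^+ 2 + b ^+ 2 = 1 -> exists t : R, cos t = a /\ sin t = b.
Proof.
move=> ab1; have a1 : -1 <= a <= 1.
  by rewrite -ler_norml -sqrtr_sqr -[leRHS]sqrtr1 ler_wsqrtr// -ab1 lerDl sqr_ge0.
have ca : cos (acos a) = a by rewrite acosK.
have sa : sin (acos a) = `|b| by rewrite sin_acos// -ab1 addrC addKr sqrtr_sqr.
have [b0|b0] := leP 0 b; [exists (acos a)|exists (- acos a)].
  by rewrite ca sa ger0_norm.
by rewrite cosN sinN ca sa ltr0_norm// opprK.
Qed.

Variable n : nat.
Implicit Types (x y : 'cV[R]_n) (A : 'M[R]_n).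

Lemma range_circle k r x y : k != 0 -> 0 < r ->
  dot x y = 0 -> dot x x = r ^+ 2 -> dot y y = r ^+ 2 ->
  range (fun s : R => cos (k * s) *: x + sin (k * s) *: y) =
  [set z | z \in <<[:: x; y]>>%VS /\ enorm z = r].
Proof.
move=> k0 r0 xy xx yy; have yx : dot y x = 0 by rewrite dotC.
apply/seteqP; split=> [_ [s _ <-]|z /= [/memv_span2[a [b ->]] zr]] /=.
  split; first by apply/memv_span2; exists (cos (k * s)), (sin (k * s)).
  apply: enorm_eq; first exact: ltW.
  by rewrite !dotE xy yx xx yy -[RHS]mul1r -(cos2Dsin2 (k * s)); ring.
have [t [<- <-]] : exists t : R, cos t = a /\ sin t = b.
  apply: cos_sin_surj; have r2 : r ^+ 2 != 0 by rewrite expf_neq0// gt_eqF.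
  apply: (mulIf r2); rewrite mul1r -{2}zr enorm_sqr !dotE xy yx xx yy; ring.
by exists (t / k) => //; rewrite mulrC divfK.
Qed.

(** Closed form of the solutions of [C'' = - k^2 C]. *)
Lemma harmonic_motion k (C T : R -> 'cV[R]_n) : k != 0 ->
  (forall s : R, is_derive s 1 C (T s)) ->
  (forall s : R, is_derive s 1 T (- k ^+ 2 *: C s)) ->
  forall s, C s = cos (k * s) *: C 0 + sin (k * s) *: (k^-1 *: T 0).
Proof.
move=> k0 dC dT s.
have dl (t : R) : is_derive t 1 (fun u => k * u) k.
  by apply: (is_derive_eq (is_deriveZ k (is_derive_id t 1)));
    rewrite /GRing.scale/= mulr1.
have dcos (t : R) : is_derive t 1 (fun u => cos (k * u)) (- sin (k * t) * k).
  exact: (is_derive1_comp (is_derive_cos _) (dl t)).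
have dsin (t : R) : is_derive t 1 (fun u => sin (k * u)) (cos (k * t) * k).
  exact: (is_derive1_comp (is_derive_sin _) (dl t)).
have dT' (t : R) : is_derive t 1 (fun u => k^-1 *: T u) (k^-1 *: (- k ^+ 2 *: C t)).
  exact: (is_deriveZ k^-1 (dT t)).
(* In the frame rotating with angular speed [k], the state [(C, k^-1 T)] is
   at rest. *)
have rest1 t : cos (k * t) *: C t - sin (k * t) *: (k^-1 *: T t) = C 0.
  have -> : C 0 = cos (k * 0) *: C 0 - sin (k * 0) *: (k^-1 *: T 0).
    by rewrite mulr0 cos0 sin0 scale1r scale0r subr0.
  apply: (@derive0_cst R n
    (fun u => cos (k * u) *: C u - sin (k * u) *: (k^-1 *: T u))) => u.
  apply: (is_derive_eq (is_deriveBfun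
    (is_derive_scale (dcos u) (dC u)) (is_derive_scale (dsin u) (dT' u)))).
  by apply/matrixP => i j; rewrite !mxE; field.
have rest2 t : sin (k * t) *: C t + cos (k * t) *: (k^-1 *: T t) = k^-1 *: T 0.
  have -> : k^-1 *: T 0 = sin (k * 0) *: C 0 + cos (k * 0) *: (k^-1 *: T 0).
    by rewrite mulr0 cos0 sin0 scale1r scale0r add0r.
  apply: (@derive0_cst R n
    (fun u => sin (k * u) *: C u + cos (k * u) *: (k^-1 *: T u))) => u.
  apply: (is_derive_eq (is_deriveDfun
    (is_derive_scale (dsin u) (dC u)) (is_derive_scale (dcos u) (dT' u)))).
  by apply/matrixP => i j; rewrite !mxE; field.
rewrite -(rest1 s) -(rest2 s) -[LHS]scale1r -(cos2Dsin2 (k * s)).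
by apply/matrixP => i j; rewrite !mxE; ring.
Qed.

Lemma Fspace_eigenvalue A w x : antisymmetric_mx A -> w != 0 -> x != 0 ->
  x \in Fspace A w -> eigenvalue (iA A) w%:C%C.
Proof.
move=> Aanti w0 x0 /[!memv_Fspace]/eqP AAx.
(* [x - i J x] is an eigenvector: the complex structure acts on it as [i]. *)
pose J := Jstr A w x; pose f := map_mx (real_complex R).
have trZ c (u : 'cV[R]_n) : (c *: u)^T = c *: u^T.
  by apply/matrixP => i j; rewrite !mxE.
have AxJ : x^T *m A = - (w *: J^T).
  rewrite /J /Jstr trZ scalerA mulfV// scale1r trmx_mul Aanti.
  by rewrite mulmxN opprK.
have AJx : J^T *m A = w *: x^T.
  have AJ : A *m J = - w *: x.
    rewrite /J /Jstr -scalemxAr AAx scalerA; congr (_ *: _).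
    by rewrite mulrN expr2 mulKf.
  apply: oppr_inj; rewrite -mulmxN -Aanti -trmx_mul AJ trZ.
  by rewrite scaleNr.
apply/eigenvalueP; exists (f _ _ x^T - 'i%C *: f _ _ J^T); last first.
  apply: contra x0 => /eqP/matrixP h; apply/eqP/matrixP => i j.
  have := h j i; rewrite !mxE => /(congr1 (@complex.Re R)) /=.
  by rewrite mul0r mul1r; lra.
rewrite /iA mulmxBl -!scalemxAr -!scalemxAl -!map_mxM AxJ AJx.
apply/matrixP => i j; rewrite !mxE; apply/eqP; rewrite eq_complex /=.
by apply/andP; split; apply/eqP; ring.
Qed.

End Circles.

(** * Solitons with constant functional *)

Section ConstantV.
Set Implicit Arguments.
Unset Strict Implicit.
Variables (R : realType) (n : nat) (alpha : R) (A : 'M[R]_n) (C : R -> 'cV[R]_n).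
Hypothesis alpha0 : alpha < 0.
Hypothesis Aanti : antisymmetric_mx A.
Hypothesis sol : soliton alpha A C.
Local Notation T := (derive1 C).
Local Notation E s := (expR (alpha / 2 * dot (C s) (C s))).
Variable v : R.
Hypothesis V_v : forall s, Vfun alpha A (C s) (T s) = v.

Lemma V_dot (s : R) : E s * dot (T s) (A *m C s) = v.
Proof. by rewrite -(V_v s) /Vfun enorm_sqr. Qed.

(** The derivative of [V] is the weighted square of the part of [A C] normal
    to the curve, so [A C] is tangent when [V] is constant. *)
Lemma mulmx_tangent (s : R) : A *m C s = dot (T s) (A *m C s) *: T s.
Proof.
have T1 := soliton_unit s sol.
have dC := soliton_derive s sol; have dT := soliton_derive2 s sol.
have := is_deriveMfun (is_derive_expsq alpha dC)
  (is_derive_dot dT (is_derive_mulmx A dC)).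
under eq_fun do rewrite V_dot.
move=> dV; have := is_derive_cst v s 1.
case: dV => _ dV [_]; rewrite [LHS]dV.
rewrite !dotE (dot_antisym_self (C s) Aanti) (dot_antisym_self (T s) Aanti).
rewrite (dotC (A *m C s) (T s)); set m := dot (T s) (A *m C s) => V0.
have nrm : dot (A *m C s) (A *m C s) = m ^+ 2.
  have : E s * (dot (A *m C s) (A *m C s) - m ^+ 2) = 0 by rewrite -[RHS]V0; ring.
  by move/eqP; rewrite mulf_eq0 gt_eqF ?expR_gt0//= subr_eq0 => /eqP.
apply/eqP; rewrite -subr_eq0; apply/eqP/dotxx_eq0.
by rewrite !dotE (dotC (A *m C s) (T s)) nrm T1 -/m; ring.
Qed.

Lemma V0_nullspace : v = 0 -> contained_in C (nullspace A).
Proof.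
move=> v0 s; rewrite memv_nullspace mulmx_tangent.
have /eqP := V_dot s; rewrite v0 mulf_eq0 gt_eqF ?expR_gt0//= => /eqP ->.
by rewrite scale0r.
Qed.

Section Nonzero.
Hypothesis v0 : v != 0.

Lemma tangent_speed_neq0 (s : R) : dot (T s) (A *m C s) != 0.
Proof.
by apply: contra v0 => /eqP m0; rewrite -(V_dot s) m0 mulr0.
Qed.

Lemma position_normal (s : R) : dot (C s) (T s) = 0.
Proof.
apply: (mulfI (tangent_speed_neq0 s)).
by rewrite -dotZr -mulmx_tangent dot_antisym_self// mulr0.
Qed.

Lemma rotating_derive2 (s : R) : is_derive s 1 T (alpha *: C s).
Proof.
apply: (is_derive_eq (soliton_derive2 s sol)).
rewrite position_normal (dotC (A *m _)) {1}mulmx_tangent.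
by rewrite mulr0 add0r addrK.
Qed.

Lemma rotating_norm (s : R) : dot (C s) (C s) = - alpha^-1.
Proof.
have dC := soliton_derive s sol; have dT := rotating_derive2 s.
have := is_derive_dot dC dT.
under eq_fun do rewrite position_normal.
case=> _ h; have [_] := is_derive_cst (0 : R) s 1.
rewrite [LHS]h dotZr (soliton_unit s sol) => /eqP.
rewrite addrC addr_eq0 => /eqP CC.
by apply: (mulfI (ltr0_neq0 alpha0)); rewrite CC mulrN mulfV ?ltr0_neq0.
Qed.

Lemma tangent_speed_cst (s : R) : dot (T s) (A *m C s) = dot (T 0) (A *m C 0).
Proof.
have := V_dot s; rewrite -(V_dot 0) !rotating_norm.
by move/mulfI; apply; rewrite gt_eqF ?expR_gt0.
Qed.

(** The curve runs with unit speed over a circle of radius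
    [1 / sqrt (- alpha)] in the complex line through [C 0]; [k] is its signed
    angular speed, and [w] the corresponding frequency of [A]. *)
Lemma rotating_circle : exists2 w : R,
  0 < w /\ eigenvalue (iA A) w%:C%C & circle_in A w (1 / Num.sqrt (- alpha)) C.
Proof.
pose mu := dot (T 0) (A *m C 0); pose k := Num.sg mu * Num.sqrt (- alpha).
have mu0 : mu != 0 := tangent_speed_neq0 0.
have a0 : 0 < Num.sqrt (- alpha) by rewrite sqrtr_gt0 oppr_gt0.
(* The sign of [mu] in [k] makes [k mu] positive, and [J (C 0) = k^-1 T 0]
   whatever that sign is. *)
have k2 : k ^+ 2 = - alpha.
  by rewrite exprMn sqr_sg mu0 mul1r sqr_sqrtr// oppr_ge0 ltW.
have k0 : k != 0 by rewrite mulf_neq0 ?sgr_eq0// gt_eqF.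
have w0 : 0 < k * mu.
  by rewrite /k mulrAC -[X in 0 < X * _]normrEsg mulr_gt0// normr_gt0.
have AC s : A *m C s = mu *: T s by rewrite mulmx_tangent tangent_speed_cst.
have AT : A *m T 0 = (mu * alpha) *: C 0.
  have dC := soliton_derive 0 sol; have dT := rotating_derive2 0.
  have [_ <-] := is_derive_mulmx A dC.
  under eq_fun do rewrite AC.
  have d : is_derive (0 : R) 1 (fun t => mu *: T t) (mu *: (alpha *: C 0)) :=
    is_deriveZ mu dT.
  by case: d => _ ->; rewrite scalerA.
have CC : dot (C 0) (C 0) = (1 / Num.sqrt (- alpha)) ^+ 2.
  by rewrite rotating_norm div1r exprVn sqr_sqrtr ?invrN// oppr_ge0 ltW.
have C0 : C 0 != 0.
  apply/eqP => C0; have := rotating_norm 0.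
  by rewrite C0 dot0r => /esym/eqP; rewrite oppr_eq0 invr_eq0 lt_eqF.
have CF : C 0 \in Fspace A (k * mu).
  by rewrite memv_Fspace AC -scalemxAr AT scalerA exprMn k2;
    apply/eqP; congr (_ *: _); ring.
have JC : Jstr A (k * mu) (C 0) = k^-1 *: T 0.
  by rewrite /Jstr AC scalerA invfM mulfVK.
exists (k * mu).
  by split=> //; apply: (Fspace_eigenvalue Aanti _ C0 CF); rewrite gt_eqF.
exists <<[:: C 0; Jstr A (k * mu) (C 0)]>>%VS; first by exists (C 0).
rewrite JC -(range_circle k0) //.
- apply: (congr1 (fun f : R -> 'cV[R]_n => range f)); apply: funext => s.
  have dC (t : R) : is_derive t 1 C (T t) := soliton_derive t sol.
  have dT (t : R) : is_derive t 1 T (- k ^+ 2 *: C t).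
    by apply: (is_derive_eq (rotating_derive2 t)); rewrite k2 opprK.
  exact: (@harmonic_motion R n k C T k0 dC dT s).
- by rewrite divr_gt0.
- by rewrite dotZr position_normal mulr0.
- rewrite dotZl dotZr (soliton_unit 0 sol) mulr1 -expr2 exprVn k2.
  by rewrite div1r exprVn sqr_sqrtr// oppr_ge0 ltW.
Qed.

End Nonzero.
End ConstantV.

(** * The functional on circles *)

Section OnCircles.
Set Implicit Arguments.
Unset Strict Implicit.
Variables (R : realType) (n : nat) (A : 'M[R]_n) (w r : R) (D : R -> 'cV[R]_n).
Hypothesis Aanti : antisymmetric_mx A.
Hypothesis w0 : 0 < w.
Hypothesis r0 : 0 < r.
Hypothesis Dsm : smooth D.
Hypothesis Darc : arc_length D.
Hypothesis Dcirc : circle_in A w r D.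
Local Notation T := (derive1 D).
Local Notation J := (Jstr A w).

Lemma circle_norm (s : R) : dot (D s) (D s) = r ^+ 2.
Proof.
case: Dcirc => L _ rD; have : range D (D s) by exists s.
by rewrite rD /= => -[_ <-]; rewrite enorm_sqr.
Qed.

(** [T] stays in the complex line and is normal to [D], as is [J D]. *)
Lemma circle_tangent (s : R) : T s = (dot (T s) (J (D s)) / r ^+ 2) *: J (D s).
Proof.
case: Dcirc => L [x [xF x0 ->]] rD.
pose y := J x; rewrite -/y in rD; pose N := dot x x; have N0 : 0 < N := dotxx_gt0 x0.
have w0' : w != 0 by rewrite gt_eqF.
have Jy : J y = - x.
  move: xF; rewrite memv_Fspace => /eqP AAx.
  rewrite /y /Jstr -scalemxAr AAx !scalerA -[RHS]scaleN1r; congr (_ *: _).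
  by field.
have xy : dot x y = 0 by rewrite dotZr dot_antisym_self// mulr0.
have yx : dot y x = 0 by rewrite dotC.
have yy : dot y y = N.
  rewrite {1}/y /Jstr dotZl dot_mulmx_antisym// mulrN -dotZr.
  by rewrite -[w^-1 *: _]/(J y) Jy dotNr opprK.
have Jx : w^-1 *: (A *m x) = y by [].
clearbody y.
(* [N] is also the squared length of [y], so these are the coordinates in the
   orthogonal basis [x], [y]; they let [T s] be computed in the same plane. *)
have Dxy t : D t = (dot (D t) x / N) *: x + (dot (D t) y / N) *: y.
  have : range D (D t) by exists t.
  rewrite rD => -[/memv_span2[a [b ->]] _].
  by rewrite !dotE xy yx yy -/N !mulr0 addr0 add0r !mulfK ?gt_eqF.
have Txy : T s = (dot (T s) x / N) *: x + (dot (T s) y / N) *: y.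
  have dD := smooth_is_derive s Dsm.
  have dproj z : is_derive s 1 (fun t => (dot (D t) z / N) *: z)
      ((dot (T s) z / N) *: z).
    have d1 := is_deriveMfun (is_derive_dot dD (is_derive_const z s))
      (is_derive_cst N^-1 s 1).
    apply: (is_derive_eq (is_derive_scale d1 (is_derive_const z s))).
    by rewrite dot0r mulr0 scaler0 !addr0.
  have [_] := is_deriveDfun (dproj x) (dproj y).
  by under eq_fun do rewrite -Dxy; case: dD => _ ->.
have DT : dot (D s) (T s) = 0.
  have dD := smooth_is_derive s Dsm.
  have [_] := is_derive_dot dD dD.
  under eq_fun do rewrite circle_norm.
  have [_ ->] := is_derive_cst (r ^+ 2) s 1.
  by rewrite (dotC (T s)); lra.
have [a [b Tab]] : exists a b, T s = a *: x + b *: y by do 2 eexists; exact: Txy.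
have [p [q Dpq]] : exists p q, D s = p *: x + q *: y by do 2 eexists; exact: Dxy.
have JD : J (D s) = p *: y - q *: x.
  rewrite Dpq /Jstr mulmxDr -!scalemxAr scalerDr !scalerA !(mulrC w^-1).
  by rewrite -!scalerA Jx -[w^-1 *: (A *m y)]/(J y) Jy scalerN.
have pqN : r ^+ 2 = N * (p ^+ 2 + q ^+ 2).
  by rewrite -(circle_norm s) Dpq !dotE xy yx yy -/N; ring.
have S0 : p ^+ 2 + q ^+ 2 != 0.
  apply/eqP => S0; move/eqP: pqN; rewrite S0 mulr0 expf_eq0/=.
  by rewrite gt_eqF.
have pa : p * a + q * b = 0.
  apply: (mulfI (lt0r_neq0 N0)); rewrite mulr0 -DT Dpq Tab !dotE xy yx yy -/N.
  ring.
have -> : dot (T s) (J (D s)) / r ^+ 2 = (p * b - q * a) / (p ^+ 2 + q ^+ 2).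
  rewrite pqN JD Tab !dotE xy yx yy -/N; field.
  by rewrite S0 gt_eqF.
set c := _ / _; have cS : c * (p ^+ 2 + q ^+ 2) = p * b - q * a by rewrite divfK.
have ac : a = - (c * q).
  apply: (mulIf S0); have := congr1 ( *%R p) pa.
  by have := congr1 ( *%R q) cS; lra.
have bc : b = c * p.
  apply: (mulIf S0); have := congr1 ( *%R q) pa.
  by have := congr1 ( *%R p) cS; lra.
by rewrite JD Tab {1}ac {1}bc; apply/matrixP => i j; rewrite !mxE; ring.
Qed.

Lemma circle_speed_sqr (s : R) : dot (T s) (J (D s)) ^+ 2 = r ^+ 2.
Proof.
have T1 : dot (T s) (T s) = 1 by rewrite -enorm_sqr Darc expr1n.
have := T1; rewrite [X in dot X _]circle_tangent dotZl (dotC (J _)) => h.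
by rewrite -[RHS]mulr1 -h; field; rewrite gt_eqF.
Qed.

Lemma circle_speed : exists b : bool, forall s, dot (T s) (J (D s)) = (-1) ^+ b * r.
Proof.
pose g s := dot (T s) (J (D s)).
have g0 s : g s != 0.
  apply/eqP => gs; have /eqP := circle_speed_sqr s.
  by rewrite -/(g s) gs expr0n/= eq_sym expf_eq0/= gt_eqF.
(* [g^2] is constant, so [2 g g' = 0], and [g] has no zero. *)
have gcst s : g s = g 0.
  apply: is_derive_0_is_cst => {}s.
  have dJ : is_derive s 1 (fun t => J (D t)) (J (T s)) :=
    is_deriveZ w^-1 (is_derive_mulmx A (smooth_is_derive s Dsm)).
  have dg := is_derive_dot (smooth_is_derive2 s Dsm) dJ.
  apply: (is_derive_eq dg).
  have [_] := is_deriveMfun dg dg.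
  under eq_fun do rewrite -expr2 circle_speed_sqr.
  have [_ ->] := is_derive_cst (r ^+ 2) s 1.
  rewrite mulrC -mulrDl => /esym/eqP; rewrite mulf_eq0 => /orP[|/eqP//].
  by rewrite -mulr2n mulrn_eq0/= (negPf (g0 s)).
have /eqP := circle_speed_sqr 0; rewrite eqf_sqr => /orP[]/eqP gr.
  by exists false => s; rewrite -/(g s) gcst /g gr mul1r.
by exists true => s; rewrite -/(g s) gcst /g gr mulN1r.
Qed.

End OnCircles.

(** * Classification *)

Theorem lemma8p2 (R : realType) (n : nat) (alpha : R) (A : 'M[R]_n)
    (m : nat) (Omega : 'I_m -> R) (C : R -> 'cV[R]_n)
    (halpha : alpha < 0)
    (hA : antisymmetric_mx A)
    (hOmega : frequencies A Omega)
    (hC : soliton alpha A C)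
    (hV : exists v : R, forall s, Vfun alpha A (C s) (derive1 C s) = v) :
  [/\ (exists k, circle_in A (Omega k) (1 / Num.sqrt (- alpha)) C) \/
      ((abresch_langer alpha C /\ contained_in C (nullspace A)) \/
       line_through_origin_in (nullspace A) C),
      forall D : R -> 'cV[R]_n,
        abresch_langer alpha D -> contained_in D (nullspace A) ->
        forall s, Vfun alpha A (D s) (derive1 D s) = 0
    & forall (k : 'I_m) (D : R -> 'cV[R]_n),
        smooth D -> arc_length D ->
        circle_in A (Omega k) (1 / Num.sqrt (- alpha)) D ->
        exists2 b : bool, circle_orientation A (Omega k) b D &
          forall s, Vfun alpha A (D s) (derive1 D s) =
            (-1) ^+ b * (Omega k / Num.sqrt (- (expR 1 * alpha)))].
Proof.
have an0 : 0 < - alpha by rewrite oppr_gt0.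
have r0 : 0 < 1 / Num.sqrt (- alpha) by rewrite divr_gt0 ?sqrtr_gt0.
split=> [|D _ DN s|k D Dsm Darc Dcirc].
- case: hV => v V_v; have [v0|v0] := eqVneq v 0; last first.
    have [w [w0 weig] Ccirc] := rotating_circle halpha hA hC V_v v0.
    case: hOmega => Opos _ /(_ w%:C%C)[Osp _]; left.
    have [|k [[wk]|/eqP]] := Osp.
      by split=> //; rewrite eq_complex/= eqxx andbT gt_eqF.
      by exists k; rewrite -wk.
    rewrite -subr_eq0 opprK eq_complex/= => /andP[/eqP h _].
    by have := Opos k; lra.
  have CN := V0_nullspace hA hC V_v v0; right.
  have hC0 : soliton alpha 0 C.
    case: hC => Csm Carc Ceq; split=> // s; cbv zeta.
    have := Ceq s; cbv zeta; have := CN s; rewrite memv_nullspace => /eqP AC.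
    by rewrite !mulmxDl AC mul0mx.
  have [Cpl|[c T0 Cline]] := shrinking_planar_or_line hC0.
    by left; exact: (conj (conj halpha (conj hC0 Cpl)) CN).
  (* [C (1 - c)] is the direction [derive1 C 0], so the latter is in the null
     space. *)
  right; exists <[derive1 C 0]>%VS; split.
  + by rewrite dim_vline T0.
  + have := CN (1 - c); rewrite Cline subrK scale1r => TN.
    by rewrite -memvE.
  + apply/seteqP; split=> [_ [s _ <-]|_ /= /vlineP[a ->]] /=.
      by rewrite Cline; apply/vlineP; exists (s + c).
    by exists (a - c) => //; rewrite Cline subrK.
- by have /[!memv_nullspace]/eqP AD := DN s; rewrite /Vfun AD dot0r mulr0.
- have Opos : 0 < Omega k by case: hOmega.
  have [b Db] := circle_speed hA Opos r0 Dsm Darc Dcirc; exists b => s.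
    exists (1 / (1 / Num.sqrt (- alpha))); first by rewrite divr_gt0.
    rewrite {1}(circle_tangent hA Opos r0 Dsm Dcirc) Db; congr (_ *: _).
    by field; rewrite gt_eqF// sqrtr_gt0.
  rewrite /Vfun enorm_sqr (circle_norm Dcirc).
  have -> : A *m D s = Omega k *: Jstr A (Omega k) (D s).
    by rewrite /Jstr scalerA mulfV ?scale1r// gt_eqF.
  rewrite dotZr Db.
  have -> : alpha / 2 * (1 / Num.sqrt (- alpha)) ^+ 2 = - 2^-1.
    rewrite div1r exprVn sqr_sqrtr ?ltW//; field; rewrite ltr0_neq0//.
  have -> : - (expR 1 * alpha) = expR 2^-1 ^+ 2 * - alpha.
    by rewrite -expRM_natl -mulrN; congr (expR _ * _); field.
  rewrite sqrtrM ?sqr_ge0// sqrtr_sqr ger0_norm ?expR_ge0// expRN.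
  by field; rewrite !gt_eqF ?expR_gt0// sqrtr_gt0.
Qed.
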